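(* Let $\varepsilon>0$ and put $\theta_\varepsilon=\varepsilon/(1+\varepsilon)$. Then the three assertions below hold. (1) If $\theta_\varepsilon<\rho_{\mathcal{W}}$, then $E_\varepsilon(\mathcal{V}_m)\ge0$ for infinitely many integers $m$. (2) If $\theta_\varepsilon>\rho_{\mathcal{W}}$, then $E_\varepsilon(\mathcal{V}_m)\ge0$ for only finitely many integers $m$. (3) There exist $\varepsilon>0$ and infinitely many $m$ satisfying $E_\varepsilon(\mathcal{V}_m)\ge0$ if and only if $\rho_{\mathcal{W}}>0$. At the boundary $\theta_\varepsilon=\rho_{\mathcal{W}}$, the normalized density alone yields no conclusion.
   Context: For $m\ge2$, $\mathcal{V}_m=(1,2^m-1,2^m)$. For a triple $(a,b,c)$ of pairwise coprime positive integers with $a+b=c$ and $\varepsilon>0$, $E_\varepsilon(a,b,c)=\log c-(1+\varepsilon)\log\mathrm{rad}(abc)$, where $\mathrm{rad}(n)$ is the product of the distinct primes dividing $n$ and $\log$ is the natural logarithm. For an odd prime $p$, let $d_p$ be the multiplicative order of $2$ modulo $p$ and $A_p=v_p(2^{d_p}-1)$, with $v_p$ the $p$-adic valuation. $\mathcal{W}$ is the set of Wieferich primes, i.e. odd primes $p$ with $2^{p-1}\equiv1\pmod{p^2}$, and $\mathcal{W}(m)=\{p\in\mathcal{W}:p\mid2^m-1\}$. Put $\Omega_m=\sum_{p\in\mathcal{W}(m)}(A_p-1)\log p$ (empty sum $=0$). The normalized Wieferich defect density is $\rho_{\mathcal{W}}=\limsup_{m\to\infty}\Omega_m/(m\log2)$,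 which satisfies $0\le\rho_{\mathcal{W}}\le1$. *)

(* Defs.v *)
From HB Require Import structures.
From mathcomp Require Import all_boot all_order all_algebra all_fingroup all_solvable.
From mathcomp Require Import all_classical all_reals all_analysis.

Set Implicit Arguments.
Unset Strict Implicit.
Unset Printing Implicit Defensive.

Import Order.TTheory GRing.Theory Num.Theory.

Local Open Scope ring_scope.

Definition rad (n : nat) : nat := (\prod_(p <- primes n) p)%N.

Definition mersenne_triple (m : nat) : nat * nat * nat :=
  (1, 2 ^ m - 1, 2 ^ m)%N.

Definition abc_triple (t : nat * nat * nat) : bool :=
  let: (a, b, c) := t in
  [&& (0 < a)%N, (0 < b)%N, (0 < c)%N, coprime a b, coprime a c, coprime b c
    & (a + b == c)%N].

Lemma mersenne_triple_abc m : (2 <= m)%N -> abc_triple (mersenne_triple m).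
Proof.
move=> m2; have h : (1 < 2 ^ m)%N by rewrite -{1}(expn0 2) ltn_exp2l //; case: m m2.
rewrite /abc_triple /mersenne_triple /= subn_gt0 h expn_gt0 /= !coprime1n /=.
rewrite subnKC ?expn_gt0 // eqxx andbT subn1.
by rewrite -{2}(prednK (ltnW h)) coprimenS.
Qed.

(* Total on triples of naturals; only its values at abc triples matter. *)
Definition abc_excess (R : realType) (eps : R) (t : nat * nat * nat) : R :=
  let: (a, b, c) := t in
  ln c%:R - (1 + eps) * ln (rad (a * b * c))%:R.

(* The default value 1 is used only when 2 is not a unit of 'F_p, which never
   happens for an odd prime p; see two_orderP. *)
Definition two_order (p : nat) : nat :=
  #[insubd (1%g : {unit 'F_p}) (2%:R : 'F_p)]%g.

Lemma two_orderP p k : prime p -> odd p ->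
  (two_order p %| k)%N = (2 ^ k == 1 %[mod p])%N.
Proof.
move=> pp op; have u2 : (2%:R : 'F_p) \is a GRing.unit.
  rewrite unitfE -(dvdn_pcharf (pchar_Fp pp)) dvdn_prime2 //.
  by apply: contraL op => /eqP ->.
rewrite /two_order order_dvdn -val_eqE FinRing.val_unitX val_insubd u2 /=.
by rewrite -natrX -[X in _ == X]/(1%:R : 'F_p) -val_eqE /= !val_Fp_nat // Fp_cast.
Qed.

Definition two_order_val (p : nat) : nat := logn p (2 ^ two_order p - 1)%N.

Definition wieferich (p : nat) : bool :=
  [&& prime p, odd p & 2 ^ (p - 1) == 1 %[mod p ^ 2]]%N.

Definition wieferich_defect (R : realType) (m : nat) : R :=
  \sum_(p <- primes (2 ^ m - 1) | wieferich p)
    ((two_order_val p)%:R - 1) * ln p%:R.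

Definition defect_density (R : realType) (omega : nat -> R) : \bar R :=
  limn_esup (fun m => (omega m / (m%:R * ln 2))%:E).

Definition wieferich_density (R : realType) : \bar R :=
  defect_density (@wieferich_defect R).

(* For m >= 1 one has
     log rad (2^m (2^m - 1))
       = log 2 + log (2^m - 1) - Omega_m - \sum_(p | 2^m - 1) v_p(m) log p,
   where Omega_m is the Wieferich defect. Hence this is what
   E_eps(1, 2^m - 1, 2^m) becomes when Omega_m is replaced by omega m and all
   the other terms are kept. *)
Definition excess_with_defect (R : realType) (eps : R) (omega : nat -> R)
    (m : nat) : R :=
  abc_excess eps (mersenne_triple m)
  + (1 + eps) * (omega m - wieferich_defect R m).

Definition theta (R : realType) (eps : R) : R := eps / (1 + eps).

(* Main.v *)
Require Import Defs.
From HB Require Import structures.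
From mathcomp Require Import all_boot all_order all_algebra.
From mathcomp Require Import all_classical all_reals all_analysis.
From mathcomp Require Import lra ring zify.

Set Implicit Arguments.
Unset Strict Implicit.
Unset Printing Implicit Defensive.

Import Order.TTheory GRing.Theory Num.Theory.

Local Open Scope classical_set_scope.
Local Open Scope ring_scope.

(** Write [N] for [2 ^ m - 1] and [L] for [m ln 2]. Lifting the exponent gives
    [v_p N = A_p + v_p m] for every prime [p] dividing [N]
    ([logn_mersenne]), where [A_p] is the valuation of [2 ^ d_p - 1]; and
    [A_p >= 2] happens exactly for the Wieferich primes ([wieferichE]).
    Summing [(v_p N - 1) ln p] over the primes dividing [N] therefore gives
    [ln N - ln (rad N) = Omega_m + T], where [T] is the logarithm of the part
    of [m] supported on the primes dividing [N], so that [0 <= T <= ln m]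
    ([ln_mersenne]). Since [ln N] differs from [L] by at most [ln 2], the
    excess is
    [(1 + eps) * (Omega_m - theta L + O(ln m))]
    ([excess_with_defectE], [mersenne_error_bound]).

    As [ln m = o(L)] ([ln_le_linear]), a limsup of [Omega_m / L] strictly above
    [theta] leaves a positive linear margin for infinitely many [m], and one
    strictly below leaves a negative linear margin for all large [m]; the error
    cannot change the sign in either case. The third assertion follows because
    [theta] is positive and [theta < eps], so [theta] can be made smaller than
    any positive density.

    The defect enters the sign results only through its density, so they are
    proved for an arbitrary sequence [omega] in place of [Omega]. At the
    boundary it is then enough to move [omega] away from [theta L] by
    [ln m + 1], upwards or downwards: the shift dominates the error, so it
    decides the sign, and it is [o(L)], so the density stays equal to [theta]
    ([defect_density_band]). *)

(** * Lifting the exponent *)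

Lemma subn1_exp x n :
  (x ^ n - 1 = (x - 1) * \sum_(i < n) x ^ i)%N.
Proof. by rewrite !subn1 predn_exp. Qed.

Lemma modn_geometric_sum p x n : (0 < x)%N -> (p %| x - 1)%N ->
  \sum_(i < n) x ^ i = n %[mod p].
Proof.
move=> x0 px; have x1 : x = 1 %[mod p] by apply/eqP; rewrite eqn_mod_dvd.
rewrite -modn_summ (eq_bigr (fun=> (1 %% p)%N)); last first.
  by move=> i _; rewrite -modnXm x1 modnXm exp1n.
by rewrite modn_summ sum_nat_const card_ord muln1.
Qed.

(** Modulo [(x - 1) ^ 2] the binomial theorem gives [x ^ i = 1 + i (x - 1)], and
    the resulting [(x - 1) * 'C(p, 2)] vanishes modulo [p ^ 2] because an odd
    [p] divides ['C(p, 2)]. *)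
Lemma modn_sqr_geometric_sum p x : prime p -> odd p -> (0 < x)%N ->
  (p %| x - 1)%N -> \sum_(i < p) x ^ i = p %[mod p ^ 2].
Proof.
move=> pp op; case: x => // y _; rewrite subn1 /= => py.
have yy : (p ^ 2 %| y * y)%N by rewrite -mulnn dvdn_mul.
have E i : y.+1 ^ i = (1 + i * y)%N %[mod p ^ 2].
  elim: i => [|i IH]; first by rewrite expn0 mul0n addn0.
  rewrite expnSr -modnMml IH modnMml.
  have -> : ((1 + i * y) * y.+1 = i * (y * y) + (1 + i.+1 * y))%N by ring.
  by rewrite -modnDml; move/(dvdn_mull i): yy => /eqP ->; rewrite add0n.
rewrite -modn_summ; under eq_bigr do rewrite E.
rewrite modn_summ big_split /=.
rewrite sum_nat_const card_ord muln1 -big_distrl /= -(big_mkord xpredT id).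
rewrite bin2_sum -modnDmr.
have p2 : (2 < p)%N by rewrite odd_prime_gt2.
have /eqP -> : ('C(p, 2) * y == 0 %[mod p ^ 2])%N.
  by rewrite mod0n -/(dvdn _ _) -mulnn dvdn_mul // prime_dvd_bin // p2.
by rewrite mod0n addn0.
Qed.

(** The factor [1 + x + ... + x ^ (n - 1)] of [x ^ n - 1] is congruent to [n]
    modulo [p], hence prime to [p] when [n] is; when [n = p] it has valuation
    exactly one. Removing the factors [p] of [n] one at a time reduces the
    general case to these two. *)
Lemma logn_expn_sub1 p x n : prime p -> odd p -> (1 < x)%N ->
  (p %| x - 1)%N -> (0 < n)%N ->
  logn p (x ^ n - 1) = (logn p (x - 1) + logn p n)%N.
Proof.
move=> pp op; elim/ltn_ind: n x => n IH x x1 px n0.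
have x0 := ltnW x1.
have sum_gt0 k : (0 < k)%N -> (0 < \sum_(i < k) x ^ i)%N.
  by case: k => // k _; rewrite big_ord_recl expn0.
have [pn|pn] := boolP (p %| n)%N; last first.
  rewrite subn1_exp lognM ?sum_gt0 ?subn_gt0 //; congr (_ + _)%N.
  rewrite [RHS]lognE [LHS]lognE (negbTE pn) !andbF.
  by rewrite /dvdn modn_geometric_sum // -/(dvdn _ _) (negbTE pn) !andbF.
case/dvdnP: pn => k nE; have k0 : (0 < k)%N by case: k nE n0 => [->|].
have p0 := prime_gt0 pp.
have xk1 : (1 < x ^ k)%N by rewrite -(exp1n k) ltn_exp2r.
have pxk : (p %| x ^ k - 1)%N by rewrite subn1_exp dvdn_mulr.
have S0 : (0 < \sum_(i < p) (x ^ k) ^ i)%N.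
  by rewrite -(prednK p0) big_ord_recl expn0.
have S1 : logn p (\sum_(i < p) (x ^ k) ^ i) = 1%N.
  have Sp := modn_sqr_geometric_sum pp op (ltnW xk1) pxk.
  apply/eqP; rewrite eqn_leq -ltnS ltnNge -!pfactor_dvdn // expn1.
  apply/andP; split.
    by rewrite /dvdn Sp -/(dvdn _ _) gtnNdvd // -mulnn ltn_Pmull // prime_gt1.
  by rewrite /dvdn modn_geometric_sum ?modnn // ltnW.
rewrite nE expnM subn1_exp lognM ?subn_gt0 // S1 IH //; last first.
  by rewrite nE -{1}(muln1 k) ltn_pmul2l // prime_gt1.
by rewrite lognM // (logn_prime p pp) eqxx addnA.
Qed.

(** * Valuations of Mersenne numbers *)

Section TwoOrder.
Variable p : nat.
Hypotheses (p_prime : prime p) (p_odd : odd p).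

Lemma two_order_dvdn k : (two_order p %| k)%N = (p %| 2 ^ k - 1)%N.
Proof. by rewrite two_orderP // eqn_mod_dvd // expn_gt0. Qed.

Lemma two_order_gt0 : (0 < two_order p)%N.
Proof. exact: fingroup.order_gt0. Qed.

Lemma two_order_dvd_pred : (two_order p %| p.-1)%N.
Proof.
rewrite two_orderP // -(totient_prime p_prime).
apply/eqP; apply: cyclic.Euler_exp_totient.
by rewrite prime_coprime // dvdn_prime2 //; apply: contraL p_odd => /eqP <-.
Qed.

Lemma logn_pred_prime_dvd k : (k %| p.-1)%N -> logn p k = 0%N.
Proof.
have p1 : (0 < p.-1)%N by rewrite -ltnS prednK ?prime_gt0 ?prime_gt1.
move=> kp; rewrite lognE; case: ifP => // /and3P[_ _ pk].
by have := dvdn_leq p1 (dvdn_trans pk kp); rewrite leqNgt ltn_predL prime_gt0.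
Qed.

(** Lifting the exponent from [2 ^ d] to [2 ^ m = (2 ^ d) ^ (m / d)], where [d]
    is the order of [2]; [m] and [m / d] have the same valuation because [d]
    divides [p - 1]. *)
Lemma logn_mersenne m : (0 < m)%N -> (p %| 2 ^ m - 1)%N ->
  logn p (2 ^ m - 1) = (two_order_val p + logn p m)%N.
Proof.
move=> m0; rewrite -two_order_dvdn => /dvdnP[k mE].
have k0 : (0 < k)%N by case: k mE m0 => [->|].
have d0 := two_order_gt0.
rewrite mE mulnC expnM logn_expn_sub1 //; last first.
- by rewrite -two_order_dvdn.
- by rewrite -{1}(expn0 2) ltn_exp2l.
by rewrite lognM // (logn_pred_prime_dvd two_order_dvd_pred).
Qed.

Lemma two_order_val_gt0 : (0 < two_order_val p)%N.
Proof.
by rewrite logn_gt0 mem_primes p_prime -two_order_dvdn dvdnn subn_gt0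
           -{1}(expn0 2) ltn_exp2l // two_order_gt0.
Qed.

(** [2 ^ (p - 1) - 1] and [2 ^ d - 1] have the same [p]-adic valuation, since
    [p] does not divide [p - 1]. *)
Lemma wieferichE : wieferich p = (1 < two_order_val p)%N.
Proof.
have p1 : (0 < p.-1)%N by rewrite -ltnS prednK ?prime_gt0 ?prime_gt1.
rewrite /wieferich p_prime p_odd subn1 /= eqn_mod_dvd ?expn_gt0 //.
rewrite pfactor_dvdn //; last by rewrite subn_gt0 -{1}(expn0 2) ltn_exp2l.
rewrite logn_mersenne // -?two_order_dvdn ?two_order_dvd_pred //.
by rewrite logn_pred_prime_dvd ?addn0.
Qed.

End TwoOrder.

Lemma rad_mersenne m : (0 < m)%N ->
  (Defs.rad (1 * (2 ^ m - 1) * 2 ^ m))%N = (2 * Defs.rad (2 ^ m - 1))%N.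
Proof.
move=> m0; have N0 : (0 < 2 ^ m - 1)%N.
  by rewrite subn_gt0 -{1}(expn0 2) ltn_exp2l.
have oN : odd (2 ^ m - 1) by rewrite oddB ?expn_gt0 // oddX eqn0Ngt m0.
rewrite /Defs.rad mul1n -(big_cons _ _ _ _ xpredT id).
apply: perm_big; apply: uniq_perm.
- exact: primes_uniq.
- by rewrite /= primes_uniq mem_primes N0 dvdn2 oN.
move=> q; rewrite primesM ?expn_gt0 //.
by rewrite primesX // (@primes_prime 2) // !inE orbC.
Qed.

(** * The logarithmic form of the excess *)

Section Excess.
Variable R : realType.
Implicit Types (eps t c : R) (omega : nat -> R) (m : nat).

Lemma ln_prodn (s : seq nat) (f : nat -> nat) : {in s, forall i, (0 < f i)%N} ->
  ln (\prod_(i <- s) f i)%N%:R = \sum_(i <- s) ln (f i)%:R :> R.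
Proof.
elim: s => [|a s IH] h; first by rewrite !big_nil ln1.
rewrite !big_cons natrM lnM ?IH // ?posrE ?ltr0n.
- by move=> i si; apply: h; rewrite inE si orbT.
- by apply: h; rewrite inE eqxx.
- by rewrite big_seq prodn_cond_gt0 // => i si; apply: h; rewrite inE si orbT.
Qed.

(** Taking [k = n] gives the factorisation of [ln n], and taking [n] a Mersenne
    number and [k = m] its exponent gives the sublinear term of the excess. *)
Lemma sum_logn_ln n k : (0 < k <= n)%N ->
  \sum_(p <- primes n) (logn p k)%:R * ln p%:R = ln (k`_\pi(n))%:R :> R.
Proof.
move=> /andP[k0 kn]; rewrite (widen_partn _ kn) -big_filter filter_pi_of //.
rewrite ln_prodn => [|p]; last first.
  by rewrite mem_primes expn_gt0 => /andP[/prime_gt0->].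
rewrite !big_seq; apply: eq_bigr => p.
rewrite mem_primes => /andP[/prime_gt0 p0 _].
by rewrite natrX lnXn ?ltr0n // mulr_natl.
Qed.

(** What separates the normalised excess from [omega m - theta * m ln 2]: the
    contribution of the valuations of [m], the gap between [ln (2 ^ m - 1)] and
    [ln (2 ^ m)], and the factor [2] of the radical. *)
Definition mersenne_error (m : nat) : R :=
  ln (m`_\pi((2 ^ m - 1)%N))%:R + (m%:R * ln 2 - ln (2 ^ m - 1)%N%:R) - ln 2.

(** A prime [p] of [2 ^ m - 1] has valuation [1 + (A_p - 1) + v_p m] there, and
    the three summands give the three terms on the right. The defect sums over
    Wieferich primes only, but the term [A_p - 1] is zero at the others. *)
Lemma ln_mersenne m : (0 < m)%N ->
  ln (2 ^ m - 1)%N%:R = ln (Defs.rad (2 ^ m - 1)%N)%:R + wieferich_defect R m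
                        + ln (m`_\pi((2 ^ m - 1)%N))%:R.
Proof.
move=> m0; have mN : (m <= 2 ^ m - 1)%N.
  by rewrite subn1; case: (2 ^ m)%N (ltn_expl m (isT : (1 < 2)%N)).
have N0 := leq_trans m0 mN.
rewrite -[in LHS](partn_pi N0) -!sum_logn_ln ?m0 ?N0 //=.
rewrite /Defs.rad ln_prodn => [|p]; last first.
  by rewrite mem_primes => /andP[/prime_gt0].
rewrite /wieferich_defect (big_mkcond (fun p => wieferich p)) -!big_split /=.
rewrite !big_seq; apply: eq_bigr => p; rewrite mem_primes => /and3P[pp _ pN].
have op : odd p.
  case: (even_prime pp) pN => // ->.
  by rewrite dvdn2 oddB ?expn_gt0 // oddX eqn0Ngt m0.
rewrite (logn_mersenne pp op) // (wieferichE pp op).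
have := two_order_val_gt0 pp op; rewrite leq_eqVlt => /predU1P[<-|A1].
  by rewrite ltnn natrD; ring.
by rewrite A1 natrD; ring.
Qed.

Lemma ln2_gt0 : 0 < ln 2 :> R.
Proof. by rewrite ln_gt0 // ltr1n. Qed.

Lemma ln_le_sub1 (x : R) : 0 < x -> ln x <= x - 1.
Proof. by move=> x0; rewrite -{1}(subrK 1 x) addrC le_ln1Dx; lra. Qed.

(** The part of [m] supported on given primes lies between [1] and [m], and
    [2 ^ m - 1] between [2 ^ (m - 1)] and [2 ^ m]; so the error lies between
    [- ln 2] and [ln m], and [ln 2 <= 1]. *)
Lemma mersenne_error_bound m : (0 < m)%N ->
  - (ln m%:R + 1) <= mersenne_error m < ln m%:R + 1.
Proof.
move=> m0; have pm0 : (0 < m`_\pi((2 ^ m - 1)%N))%N by exact: part_gt0.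
have T0 : 0 <= ln (m`_\pi((2 ^ m - 1)%N))%:R :> R by rewrite ln_ge0 // ler1n.
have T1 : ln (m`_\pi((2 ^ m - 1)%N))%:R <= ln m%:R :> R.
  by rewrite ler_ln ?posrE ?ltr0n // ler_nat dvdn_leq // dvdn_part.
have m1 : (1 < 2 ^ m)%N by rewrite -{1}(expn0 2) ltn_exp2l.
have N0 : (0 < 2 ^ m - 1)%N by rewrite subn_gt0.
have E : m%:R * ln 2 = ln (2 ^ m)%N%:R :> R.
  by rewrite natrX lnXn ?ltr0n // mulr_natl.
have D0 : ln (2 ^ m - 1)%N%:R <= m%:R * ln 2 :> R.
  by rewrite E ler_ln ?posrE ?ltr0n ?expn_gt0 // ler_nat leq_subr.
have D1 : m%:R * ln 2 <= ln 2 + ln (2 ^ m - 1)%N%:R :> R.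
  rewrite E -lnM ?posrE ?ltr0n // -natrM.
  rewrite ler_ln ?posrE ?ltr0n ?expn_gt0 ?muln_gt0 //.
  rewrite ler_nat mulnBr muln1 mul2n -addnn -addnBA ?leq_addr //.
have L : ln 2 <= 1 :> R by have := @ln_le_sub1 2 (ltr0Sn _ 1); lra.
have L0 := ln2_gt0.
by rewrite /mersenne_error; apply/andP; split; lra.
Qed.

Lemma excess_with_defectE eps omega m : 0 < eps -> (0 < m)%N ->
  excess_with_defect eps omega m =
  (1 + eps) * (omega m - theta eps * (m%:R * ln 2) + mersenne_error m).
Proof.
move=> e0 m0; rewrite /excess_with_defect /abc_excess /mersenne_triple.
rewrite (_ : Defs.rad _ = (2 * Defs.rad (2 ^ m - 1))%N); last first.
  exact: rad_mersenne.
have N0 : (0 < 2 ^ m - 1)%N by rewrite subn_gt0 -{1}(expn0 2) ltn_exp2l.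
have r0 : (0 < Defs.rad (2 ^ m - 1)%N)%N.
  rewrite /Defs.rad big_seq prodn_cond_gt0 // => p.
  by rewrite mem_primes => /andP[/prime_gt0].
rewrite natrM lnM ?posrE ?ltr0n // natrX lnXn ?ltr0n //.
rewrite /mersenne_error (ln_mersenne m0) /theta -mulr_natl.
by field; lra.
Qed.

Lemma abc_excessE eps m :
  abc_excess eps (mersenne_triple m) =
  excess_with_defect eps (@wieferich_defect R) m.
Proof. by rewrite /excess_with_defect subrr mulr0 addr0. Qed.

(** In this sign criterion and the next the band [ln m + 1] is the bound on the
    error; its upper bound is strict, which makes the negative sign strict. *)
Lemma excess_ge0 eps omega m : 0 < eps -> (0 < m)%N ->
  theta eps * (m%:R * ln 2) + (ln m%:R + 1) <= omega m ->
  0 <= excess_with_defect eps omega m.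
Proof.
move=> e0 m0 h; rewrite excess_with_defectE // mulr_ge0 //; first lra.
by have /andP[] := mersenne_error_bound m0; lra.
Qed.

Lemma excess_lt0 eps omega m : 0 < eps -> (0 < m)%N ->
  omega m <= theta eps * (m%:R * ln 2) - (ln m%:R + 1) ->
  excess_with_defect eps omega m < 0.
Proof.
move=> e0 m0 h; rewrite excess_with_defectE // pmulr_rlt0; last lra.
by have /andP[] := mersenne_error_bound m0; lra.
Qed.

(** * Densities and margins *)

(** With [s = sqrt m], [ln m = 2 ln s <= 2 (s - 1)], so the left-hand side is at
    most [2 s], which is below [c ln 2 * s ^ 2] once [s >= 2 / (c ln 2)]. *)
Lemma ln_le_linear c : 0 < c ->
  exists2 M, (0 < M)%N &
    forall m, (M <= m)%N -> ln m%:R + 1 <= c * (m%:R * ln 2) :> R.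
Proof.
move=> c0; have l0 := ln2_gt0; pose d := 2 / (c * ln 2).
have d0 : 0 < d by rewrite divr_gt0 // mulr_gt0.
exists (Num.bound (d ^+ 2)).+1 => // m mM.
have m0 : 0 < m%:R :> R by rewrite ltr0n (leq_trans _ mM).
have dm : d ^+ 2 <= m%:R.
  apply: le_trans (ltW (archi_boundP _)) _; first by rewrite exprn_ge0 // ltW.
  by rewrite ler_nat ltnW.
set s := Num.sqrt (m%:R : R).
have s0 : 0 < s by rewrite sqrtr_gt0.
have ss : s ^+ 2 = m%:R by rewrite sqr_sqrtr // ltW.
have ds : d <= s.
  by rewrite -(ler_pXn2r (ltn0Sn 1)) ?nnegrE ?(ltW d0) ?(ltW s0) // ss.
have lm : ln m%:R <= 2 * (s - 1).
  by rewrite -ss lnXn // mulr2n; have := ln_le_sub1 s0; lra.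
have cs : 2 <= c * ln 2 * s.
  have cd : c * ln 2 * d = 2 by rewrite /d; field; apply/andP; split; lra.
  by rewrite -[leLHS]cd ler_pM2l // mulr_gt0.
have : 2 * s <= c * ln 2 * s * s by rewrite ler_pM2r.
have -> : c * ln 2 * s * s = c * (m%:R * ln 2) by rewrite -ss; ring.
by lra.
Qed.

Lemma mul_ln2_gt0 m : (0 < m)%N -> 0 < m%:R * ln 2 :> R.
Proof. by move=> m0; rewrite mulr_gt0 ?ltr0n // ln2_gt0. Qed.

(** A strict inequality for a limsup is turned into a fixed real margin, which
    is what absorbs a sublinear error; likewise in [gt_defect_density]. *)
Lemma lt_defect_density t omega : (t%:E < defect_density omega)%E ->
  exists2 t', t < t' &
    forall N, exists2 m, (N < m)%N & t' * (m%:R * ln 2) < omega m.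
Proof.
rewrite /defect_density /limn_esup; set u := limf_esup _ _ => tu.
have [t' tt' t'u] : exists2 t', t < t' & (t'%:E < u)%E.
  case: u tu => [r| |] //; rewrite ?lte_fin => tr.
  - by exists ((t + r) / 2); rewrite ?lte_fin; lra.
  - by exists (t + 1); rewrite ?ltry //; lra.
exists t' => // N.
have := lt_le_trans t'u (ereal_inf_lbound _).
set v := (fun m => _) in u tu t'u *.
move=> /(_ (ereal_sup [set v m | m in [set m | (N < m)%N]])).
case/(_ _)/ereal_sup_gt.
  by exists [set m | (N < m)%N] => //; exists N.+1.
move=> _ [m /= Nm <-]; rewrite /v lte_fin.
rewrite ltr_pdivlMr ?mul_ln2_gt0 ?(leq_trans _ Nm) //.
by exists m.
Qed.

Lemma gt_defect_density t omega : (defect_density omega < t%:E)%E ->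
  exists2 t', t' < t &
    exists N, forall m, (N < m)%N -> omega m <= t' * (m%:R * ln 2).
Proof.
rewrite /defect_density /limn_esup => /ereal_inf_lt[_ [V [N _ NV] <-]].
set v := (fun m => _); set u := ereal_sup _ => ut.
have [t' tt' ut'] : exists2 t', t' < t & (u <= t'%:E)%E.
  case: u ut => [r| |] //; rewrite ?lte_fin => tr.
  - by exists r.
  - by exists (t - 1); rewrite ?leNye //; lra.
exists t' => //; exists N => m Nm; have Vm : V m by apply: NV; exact: ltnW.
have : (v m <= t'%:E)%E.
  by apply: le_trans ut'; apply: ereal_sup_ubound; exists m.
by rewrite /v lee_fin ler_pdivrMr // mul_ln2_gt0 // (leq_trans _ Nm).
Qed.

(** A density other than [t] would leave a linear margin on one side, which a
    deviation of [ln m + 1] cannot reach for large [m]. *)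
Lemma defect_density_band t omega :
  (forall m, (0 < m)%N -> `|omega m - t * (m%:R * ln 2)| <= ln m%:R + 1) ->
  defect_density omega = t%:E.
Proof.
move=> band.
case: (ltgtP (defect_density omega) t%:E) => // cmp; exfalso; move: cmp.
- case/gt_defect_density => t' t't [N h].
  have d0 : 0 < (t - t') / 2 by lra.
  have [M M0 hM] := ln_le_linear d0.
  have m0 : (0 < (N + M).+1)%N by [].
  have := hM _ (leq_trans (leq_addl N M) (leqnSn _)).
  have := h (N + M).+1 (leq_addr M N).
  have := mul_ln2_gt0 m0.
  have := band _ m0; rewrite ler_norml => /andP[].
  move: (_ * ln 2) => x; nra.
- case/lt_defect_density => t' t't h.
  have d0 : 0 < (t' - t) / 2 by lra.
  have [M M0 hM] := ln_le_linear d0.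
  have [m Mm] := h M.
  have m0 := leq_trans M0 (ltnW Mm).
  have := hM _ (ltnW Mm).
  have := mul_ln2_gt0 m0.
  have := band _ m0; rewrite ler_norml => /andP[].
  move: (_ * ln 2) => x; nra.
Qed.

Lemma infinite_set_nat (A : set nat) :
  (forall N, exists2 m, (N < m)%N & A m) -> infinite_set A.
Proof.
move=> h /finite_seqP[X AE]; have [m] := h (\max_(i <- X) i)%N.
rewrite AE /= => mlt mX.
by move: mlt; rewrite ltnNge (@leq_bigmax_seq _ X xpredT id m).
Qed.

Lemma finite_set_nat (A : set nat) N :
  (forall m, (N < m)%N -> ~ A m) -> finite_set A.
Proof.
move=> h; apply: sub_finite_set (finite_II N.+1) => m Am /=.
by rewrite ltnNge; apply/negP => /h.
Qed.

(** * The sign of the excess away from the boundary *)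

Lemma infinite_excess eps omega : 0 < eps ->
  ((theta eps)%:E < defect_density omega)%E ->
  infinite_set [set m | (2 <= m)%N /\ 0 <= excess_with_defect eps omega m].
Proof.
move=> e0 /lt_defect_density[t' tt' h].
have [M M0 hM] := ln_le_linear (ltac:(lra) : 0 < t' - theta eps).
apply: infinite_set_nat => N; have [m Nm mh] := h (N + M).+1.
have m1 : (1 < m)%N by lia.
exists m; first by lia.
split => //; apply: excess_ge0 => //; first exact: ltnW.
by have := hM m ltac:(lia); lra.
Qed.

Lemma finite_excess eps omega : 0 < eps ->
  (defect_density omega < (theta eps)%:E)%E ->
  finite_set [set m | (2 <= m)%N /\ 0 <= excess_with_defect eps omega m].
Proof.
move=> e0 /gt_defect_density[t' tt' [N h]].
have [M M0 hM] := ln_le_linear (ltac:(lra) : 0 < theta eps - t').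
apply: (@finite_set_nat _ (N + M)) => m Nm [m1].
apply/negP; rewrite -ltNge; apply: excess_lt0 => //; first exact: ltnW.
by have := hM m ltac:(lia); have := h m ltac:(lia); lra.
Qed.

Lemma theta_gt0 eps : 0 < eps -> 0 < theta eps.
Proof. by move=> e0; rewrite divr_gt0 // addr_gt0. Qed.

Lemma theta_lt1 eps : 0 < eps -> theta eps < 1.
Proof. by move=> e0; rewrite ltr_pdivrMr ?addr_gt0 // mul1r ltrDr. Qed.

Lemma theta_lt eps : 0 < eps -> theta eps < eps.
Proof. by move=> e0; rewrite ltr_pdivrMr ?addr_gt0 //; nra. Qed.

(** * Sequences at the boundary *)

(** The truncations in this definition and the next enforce
    [0 <= omega m <= m ln 2]. The first one is inactive for large [m] because
    [theta < 1], and the second one because [theta > 0]. *)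
Definition upper_band_defect eps m : R :=
  Num.min (m%:R * ln 2) (theta eps * (m%:R * ln 2) + (ln m%:R + 1)).

Definition lower_band_defect eps m : R :=
  Num.max 0 (theta eps * (m%:R * ln 2) - (ln m%:R + 1)).

Lemma ln_nat_ge0 m : 0 <= ln m%:R :> R.
Proof. by case: m => [|m]; [rewrite ln0 | rewrite ln_ge0 ?ler1n]. Qed.

Lemma theta_mul_ln2 eps m : 0 < eps ->
  0 <= theta eps * (m%:R * ln 2) <= m%:R * ln 2.
Proof.
move=> e0; have x0 : 0 <= m%:R * ln 2 :> R.
  by rewrite mulr_ge0 // ltW // ln2_gt0.
by rewrite mulr_ge0 ?(ltW (theta_gt0 e0)) //= ler_piMl // ltW // theta_lt1.
Qed.

End Excess.

Theorem theorem6p7 (R : realType) (eps : R) (eps_gt0 : 0 < eps) :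
  [/\ (* (1) *)
      ((theta eps)%:E < wieferich_density R)%E ->
        infinite_set [set m : nat |
          (2 <= m)%N /\ 0 <= abc_excess eps (mersenne_triple m)],
      (* (2) *)
      (wieferich_density R < (theta eps)%:E)%E ->
        finite_set [set m : nat |
          (2 <= m)%N /\ 0 <= abc_excess eps (mersenne_triple m)],
      (* (3) *)
      (exists2 eps' : R, 0 < eps' &
        infinite_set [set m : nat |
          (2 <= m)%N /\ 0 <= abc_excess eps' (mersenne_triple m)])
      <-> (0 < wieferich_density R)%E
    & (* at the boundary, the density of the defect sequence does not decide *)
      exists omega1 omega2 : nat -> R,
        [/\ (forall m, 0 <= omega1 m <= m%:R * ln 2) /\
            (forall m, 0 <= omega2 m <= m%:R * ln 2),
            defect_density omega1 = (theta eps)%:E,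
            defect_density omega2 = (theta eps)%:E,
            infinite_set [set m : nat |
              (2 <= m)%N /\ 0 <= excess_with_defect eps omega1 m]
          & finite_set [set m : nat |
              (2 <= m)%N /\ 0 <= excess_with_defect eps omega2 m]]].
Proof.
have setE e :
    [set m : nat | (2 <= m)%N /\ 0 <= abc_excess e (mersenne_triple m)] =
    [set m | (2 <= m)%N /\ 0 <= excess_with_defect e (@wieferich_defect R) m].
  by apply/seteqP; split => m; rewrite /mkset abc_excessE.
split.
- by rewrite setE; exact: infinite_excess.
- by rewrite setE; exact: finite_excess.
- split=> [[e e0 inf_e]|rho_gt0].
    rewrite ltNge; apply/negP => rho_le0; apply: inf_e; rewrite setE.
    apply: finite_excess => //; apply: le_lt_trans rho_le0 _.
    by rewrite lte_fin theta_gt0.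
  have [e [e0 e_rho]] : exists e : R, 0 < e /\ (e%:E < wieferich_density R)%E.
    case: (wieferich_density R) rho_gt0 => [r| |] //; rewrite ?lte_fin => r0.
    - by exists (r / 2); rewrite lte_fin; lra.
    - by exists 1; rewrite ltry.
  (* theta < eps makes any parameter below the density work *)
  exists e => //; rewrite setE; apply: infinite_excess => //.
  by apply: lt_trans e_rho; rewrite lte_fin theta_lt.
exists (upper_band_defect eps), (lower_band_defect eps); split.
- split=> m; have l0 := ln_nat_ge0 R m;
    have /andP[x0 x1] := theta_mul_ln2 m eps_gt0.
    rewrite /upper_band_defect le_min ge_min lexx /= andbT.
    by apply/andP; split; lra.
  rewrite /lower_band_defect le_max lexx ge_max /=.
  by apply/andP; split; lra.
- apply: defect_density_band => m _; rewrite /upper_band_defect ler_norml.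
  have l0 := ln_nat_ge0 R m; have /andP[x0 x1] := theta_mul_ln2 m eps_gt0.
  rewrite lerBrDr lerBlDr le_min ge_min.
  rewrite [X in _ || (_ <= X)]addrC lexx orbT andbT.
  by apply/andP; split; lra.
- apply: defect_density_band => m _; rewrite /lower_band_defect ler_norml.
  have l0 := ln_nat_ge0 R m; have /andP[x0 x1] := theta_mul_ln2 m eps_gt0.
  rewrite lerBrDr lerBlDr le_max ge_max addrC lexx orbT /=.
  by apply/andP; split; lra.
- have d0 : 0 < 1 - theta eps by rewrite subr_gt0 theta_lt1.
  have [M M0 hM] := ln_le_linear d0.
  apply: infinite_set_nat => N; exists (N + M).+2; first by lia.
  split => //; apply: excess_ge0 => //.
  rewrite /upper_band_defect le_min lexx andbT.
  by have := hM (N + M).+2 ltac:(lia); lra.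
have [M M0 hM] := ln_le_linear (theta_gt0 eps_gt0).
apply: (@finite_set_nat _ M) => m Mm [m1].
apply/negP; rewrite -ltNge; apply: excess_lt0 => //; first exact: ltnW.
rewrite /lower_band_defect ge_max lexx andbT.
by have := hM m ltac:(lia); lra.
Qed.
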